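(* Let $n,m\in\mathbb{N}$, $b\in\mathbb{R}$ with $b>0$, let $A\in\{0,1\}^{n\times m}$ have no zero column, let $\{\mathbf{0}_m,b\mathbf{e}_1,\dots,b\mathbf{e}_m\}\subseteq X\subseteq\mathbb{R}^m_+$, and let $f:X\to\mathbb{R}$ satisfy $f(\mathbf{0}_m)=0$ and be $b$-individually subadditive, i.e. $f(x)\le b^{-1}\sum_{j=1}^m x_jf(b\mathbf{e}_j)$ for all $x\in X$. Let $F(x)=b^{-1}\sum_{j=1}^m f(b\mathbf{e}_j)x_j$ for $x\in\mathbb{R}^m$, and for $w\in\{0,1\}^n$ define $$\nu_{X,f}(w)=\max_{x\in X}[f(x):Ax\le bw],\qquad \nu_{\mathbb{R}^m_+,F}(w)=\max_{x\in\mathbb{R}^m_+}[F(x):Ax\le bw].$$ Then: (i) $\mathrm{core}(\nu_{X,f})\ne\emptyset$ if and only if $\nu_{X,f}(\mathbf{1}_n)=\nu_{\mathbb{R}^m_+,F}(\mathbf{1}_n)$. (ii) Whenever $\mathrm{core}(\nu_{X,f})$ is non-empty, $$\mathrm{core}(\nu_{X,f})=\operatorname*{arg\,min}_{y\in\mathbb{R}^n_+}\left[\mathbf{1}_n^Ty:\ y^TA\ge(f(b\mathbf{e}_1),\dots,f(b\mathbf{e}_m))\right].$$ (iii) If $X=\{0,1\}^m$ and $\mathrm{core}(\nu_{X,f})$ is non-empty, then the linear program $\max_{x\in\mathbb{R}^m_+}[F(x):Ax\le b\mathbf{1}_n]$ has an integer optimal solution.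
   Context: Notation: $\mathbf{0}_n,\mathbf{1}_n$ are the all-zero and all-one vectors in $\mathbb{R}^n$; $\mathbf{e}_j$ is the $j$-th unit vector; $\mathbb{R}^m_+$ is the set of componentwise non-negative vectors; vector inequalities are componentwise. Standing convention: the maximum defining $\nu_{X,f}(w)$ is attained for every $w\in\{0,1\}^n$. The core of a (revenue) game $\nu:\{0,1\}^n\to\mathbb{R}$ is $\mathrm{core}(\nu)=\{y\in\mathbb{R}^n:\mathbf{1}_n^Ty=\nu(\mathbf{1}_n),\ a^Ty\ge\nu(a)\ \forall a\in\{0,1\}^n\}$. *)

(* Defs.v *)
From mathcomp Require Import all_boot all_order all_algebra.
From mathcomp Require Import boolp classical_sets reals.

Set Implicit Arguments.
Unset Strict Implicit.
Unset Printing Implicit Defensive.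

Import Order.TTheory GRing.Theory Num.Theory.
Local Open Scope classical_set_scope.
Local Open Scope ring_scope.

(* Vectors of R^n are column vectors, and {0,1}^n is a subset of R^n.
   A function on a subset of R^n (the objective f : X -> R, a game
   nu : {0,1}^n -> R) is a total function; each definition below only uses its
   values on that subset. *)
Section Defs.
Context {R : realType}.

Definition mxle (p q : nat) (u v : 'M[R]_(p, q)) : Prop :=
  forall i j, u i j <= v i j.

Definition nonneg (p q : nat) : set 'M[R]_(p, q) := [set u | mxle 0 u].

Definition binary (p q : nat) : set 'M[R]_(p, q) :=
  [set u | forall i j, u i j = 0 \/ u i j = 1].

Definition dot (n : nat) (u v : 'cV[R]_n) : R := (u^T *m v) ord0 ord0.

Definition ones (n : nat) : 'cV[R]_n := const_mx 1.

Definition unitv (m : nat) (j : 'I_m) : 'cV[R]_m := delta_mx j ord0.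

Definition argmax (T : Type) (D : set T) (g : T -> R) : set T :=
  [set x | D x /\ forall z, D z -> g z <= g x].

Definition argmin (T : Type) (D : set T) (g : T -> R) : set T :=
  [set x | D x /\ forall z, D z -> g x <= g z].

(* The common value of g on argmax D g; 0 if the maximum is not attained. *)
Definition maxval (T : Type) (D : set T) (g : T -> R) : R :=
  xget 0 (g @` argmax D g).

Definition feasible (n m : nat) (A : 'M[R]_(n, m)) (b : R)
    (X : set 'cV[R]_m) (w : 'cV[R]_n) : set 'cV[R]_m :=
  [set x | X x /\ mxle (A *m x) (b *: w)].

Definition revenue (n m : nat) (A : 'M[R]_(n, m)) (b : R)
    (X : set 'cV[R]_m) (f : 'cV[R]_m -> R) (w : 'cV[R]_n) : R :=
  maxval (feasible A b X w) f.

Definition core (n : nat) (nu : 'cV[R]_n -> R) : set 'cV[R]_n :=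
  [set y | dot (ones n) y = nu (ones n) /\
           forall a, binary a -> nu a <= dot a y].

Definition individually_subadditive (m : nat) (b : R) (X : set 'cV[R]_m)
    (f : 'cV[R]_m -> R) : Prop :=
  forall x, X x -> f x <= b^-1 * \sum_(j < m) x j ord0 * f (b *: unitv j).

Definition linear_ext (m : nat) (b : R) (f : 'cV[R]_m -> R) (x : 'cV[R]_m) : R :=
  b^-1 * \sum_(j < m) f (b *: unitv j) * x j ord0.

End Defs.

Arguments nonneg {R} p q.
Arguments binary {R} p q.
Arguments ones {R} n.

(* Main.v *)
Require Import Defs.
From mathcomp Require Import all_boot all_order all_algebra.
From mathcomp Require Import boolp classical_sets reals.

(** The linear program max F(x) subject to A x <= b w, x >= 0 relaxes the
    problem defining nu(w), because f <= F on X by subadditivity.  Its dual is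
    to minimise w^T y over the polyhedron of all y >= 0 with
    y^T A >= (f(b e_1), ..., f(b e_m)), and this polyhedron does not depend
    on w.  Two facts link it to the core.

    First, every core vector y lies in the polyhedron: testing the core
    inequality on the unit vector e_i gives y_i >= nu(e_i) >= f(0) = 0, and
    testing it on the j-th column of A, which is binary, gives
    (y^T A)_j >= f(b e_j) since b e_j is admissible for that column
    ([core_dual_feasible]).  Secondly, by weak duality every y in the
    polyhedron satisfies w^T y >= F(x) >= f(x) for all x admissible for w, that
    is w^T y >= nu(w) ([weak_duality], [revenue_le_dual]).  Hence the core
    consists of the points of the polyhedron with 1^T y = nu(1)
    ([coreE]).

    If the core contains some y, then a maximiser x of f over X satisfies
    F(x) >= f(x) = 1^T y, so weak duality makes x optimal for the linear
    program and y optimal for its dual ([core_argmax]).  This gives the equality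
    of optimal values, the description of the core as the set of dual
    optima and, as x lies in X, the integer optimal solution.

    Conversely, the dual polyhedron is non-empty because A has no zero column
    ([dual_feasible_exists]), so strong duality ([lp_strong_duality]) yields
    optimal x and y with 1^T y = F(x).  When this common value is nu(1), the
    vector y is in the core.  Strong duality is derived from Farkas' lemma
    ([farkas]), proved by induction on the number of inequalities. *)

Set Implicit Arguments.
Unset Strict Implicit.
Unset Printing Implicit Defensive.

Import Order.TTheory GRing.Theory Num.Theory.
Local Open Scope classical_set_scope.
Local Open Scope ring_scope.

(** * The componentwise order on matrices *)

Section MatrixOrder.
Context {R : realType}.

Lemma mxle_trans p q (v u w : 'M[R]_(p, q)) : mxle u v -> mxle v w -> mxle u w.
Proof. by move=> uv vw i j; exact: le_trans (uv i j) (vw i j). Qed.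

Lemma mxle_mul2l p q r (u : 'M[R]_(p, q)) (v w : 'M[R]_(q, r)) :
  mxle 0 u -> mxle v w -> mxle (u *m v) (u *m w).
Proof.
move=> u0 vw i j; rewrite !mxE; apply: ler_sum => k _.
by apply: ler_wpM2l (vw k j); have := u0 i k; rewrite mxE.
Qed.

Lemma mxle_mul2r p q r (u : 'M[R]_(q, r)) (v w : 'M[R]_(p, q)) :
  mxle 0 u -> mxle v w -> mxle (v *m u) (w *m u).
Proof.
move=> u0 vw i j; rewrite !mxE; apply: ler_sum => k _.
by apply: ler_wpM2r (vw i k); have := u0 k j; rewrite mxE.
Qed.

Lemma mxle_tr p q (u v : 'M[R]_(p, q)) : mxle u v -> mxle u^T v^T.
Proof. by move=> uv i j; rewrite !mxE. Qed.

Lemma mxle_scale p q (a : R) (u v : 'M[R]_(p, q)) :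
  0 <= a -> mxle u v -> mxle (a *: u) (a *: v).
Proof. by move=> a0 uv i j; rewrite !mxE; apply: ler_wpM2l (uv i j). Qed.

Lemma mxle_subr0 p q (u v : 'M[R]_(p, q)) : mxle (u - v) 0 <-> mxle u v.
Proof.
by split=> uv i j; have := uv i j; rewrite !mxE subr_le0.
Qed.

Lemma mxle_sub0r p q (u v : 'M[R]_(p, q)) : mxle 0 (v - u) <-> mxle u v.
Proof.
by split=> uv i j; have := uv i j; rewrite !mxE subr_ge0.
Qed.

Lemma mxle_opp p q (u v : 'M[R]_(p, q)) : mxle (- u) (- v) <-> mxle v u.
Proof.
by split=> uv i j; have := uv i j; rewrite !mxE lerN2.
Qed.

Lemma mxle_col_mx p1 p2 q (u1 v1 : 'M[R]_(p1, q)) (u2 v2 : 'M[R]_(p2, q)) :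
  mxle (col_mx u1 u2) (col_mx v1 v2) <-> mxle u1 v1 /\ mxle u2 v2.
Proof.
split=> [uv | [uv1 uv2] i j].
  split=> i j; [have := uv (lshift p2 i) j | have := uv (rshift p1 i) j].
    by rewrite !col_mxEu.
  by rewrite !col_mxEd.
by rewrite -(splitK i); case: (split i) => k; rewrite ?col_mxEu ?col_mxEd.
Qed.

Lemma mxle_row_mx p q1 q2 (u1 v1 : 'M[R]_(p, q1)) (u2 v2 : 'M[R]_(p, q2)) :
  mxle (row_mx u1 u2) (row_mx v1 v2) <-> mxle u1 v1 /\ mxle u2 v2.
Proof.
split=> [uv | [uv1 uv2] i j].
  split=> i j; [have := uv i (lshift q2 j) | have := uv i (rshift q1 j)].
    by rewrite !row_mxEl.
  by rewrite !row_mxEr.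
by rewrite -(splitK j); case: (split j) => k; rewrite ?row_mxEl ?row_mxEr.
Qed.

Lemma mxle11 (u v : 'M[R]_1) : mxle u v <-> u ord0 ord0 <= v ord0 ord0.
Proof. by split=> [|uv i j]; [exact | rewrite !ord1]. Qed.

End MatrixOrder.

(** * Farkas' lemma and linear programming duality *)

Section Duality.
Context {R : realType}.

(** Farkas' lemma, by Bartl's induction on the number of inequalities: if
    the inequality a x <= 0 cannot be dropped, it is eliminated by projecting
    along a witness x0 of that fact onto the hyperplane a x = 0. *)
Lemma farkas m n (A : 'M[R]_(m, n)) (c : 'rV[R]_n) :
  (forall x : 'cV[R]_n, mxle (A *m x) 0 -> mxle (c *m x) 0) ->
  exists2 u : 'rV[R]_m, mxle 0 u & c = u *m A.
Proof.
elim: m => [|m IHm] in A c *.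
  move=> cP; exists 0; first by move=> ? [].
  apply/rowP => j; rewrite mul0mx mxE; apply/eqP; rewrite eq_le.
  have cle0 (x : 'cV[R]_n) : (c *m x) ord0 ord0 <= 0.
    have /mxle11 : mxle (c *m x) 0 by apply: cP => -[].
    by rewrite [leRHS]mxE.
  have cE : c ord0 j = (c *m (delta_mx j 0 : 'cV_n)) ord0 ord0
    by rewrite -colE mxE.
  rewrite cE cle0 -oppr_le0.
  by have := cle0 (- delta_mx j 0); rewrite mulmxN [leLHS]mxE.
rewrite -[m.+1]/(1 + m)%N in A *; rewrite -(vsubmxK A).
move: (usubmx A) (dsubmx A) => a B {A} cP.
have [cB | ncB] := pselect (forall x : 'cV[R]_n,
    mxle (B *m x) 0 -> mxle (c *m x) 0).
  have [u u0 ->] := IHm B c cB; exists (row_mx 0 u).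
    by rewrite -row_mx0; apply/mxle_row_mx; split.
  by rewrite mul_row_col mul0mx add0r.
have [x0 Bx0 /mxle11 /negP] : exists2 x0 : 'cV[R]_n,
    mxle (B *m x0) 0 & ~ mxle (c *m x0) 0.
  by move/existsNP: ncB => [x0 /not_implyP[]]; exists x0.
rewrite [leRHS]mxE -ltNge => cx0.
set alpha := (a *m x0) ord0 ord0.
have alpha_gt0 : 0 < alpha.
  rewrite ltNge; apply/negP => alpha_le0.
  have /mxle11 : mxle (c *m x0) 0.
    apply: cP; rewrite mul_col_mx -col_mx0; apply/mxle_col_mx; split=> //.
    by apply/mxle11; rewrite [leRHS]mxE.
  by rewrite [leRHS]mxE leNgt cx0.
have ax0 : a *m x0 = alpha%:M by exact: mx11_scalar.
(* P is alpha times the projection along x0 onto the hyperplane a x = 0. *)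
pose P := alpha%:M - x0 *m a.
have aP0 : a *m P = 0.
  by rewrite mulmxBr mulmxA ax0 mul_mx_scalar mul_scalar_mx subrr.
have [x BPx | u u0 cPE] := IHm (B *m P) (c *m P).
  rewrite -mulmxA; apply: cP; rewrite mul_col_mx -col_mx0.
  by apply/mxle_col_mx; rewrite !mulmxA aP0 mul0mx; split.
(* r vanishes on that hyperplane, hence is a multiple of a; the factor
   beta / alpha is the coefficient of the inequality a x <= 0. *)
pose r := c - u *m B; pose beta := (r *m x0) ord0 ord0.
have beta_ge0 : 0 <= beta.
  rewrite /beta /r mulmxBl mxE [X in _ + X]mxE subr_ge0.
  apply: le_trans (ltW cx0).
  have /mxle11 := mxle_mul2l u0 Bx0.
  by rewrite mulmx0 mulmxA [leRHS]mxE.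
have rE : alpha *: r = beta *: a.
  have : r *m P = 0 by rewrite mulmxBl -mulmxA cPE subrr.
  rewrite mulmxBr mul_mx_scalar mulmxA => /eqP; rewrite subr_eq0 => /eqP ->.
  by rewrite {1}[r *m x0]mx11_scalar mul_scalar_mx.
exists (row_mx (beta / alpha)%:M u).
  rewrite -row_mx0; apply/mxle_row_mx; split=> //; apply/mxle11.
  by rewrite !mxE eqxx divr_ge0 // ltW.
rewrite mul_row_col mul_scalar_mx mulrC -scalerA -rE scalerA.
by rewrite mulVf ?gt_eqF // scale1r subrK.
Qed.

(** Obtained from Farkas' lemma by homogenising: the inequality s <= 0 is a
    consequence of M z <= s d, z >= 0, s >= 0. *)
Lemma lp_infeasible k n (M : 'M[R]_(k, n)) (d : 'cV[R]_k) :
  ~ (exists2 z : 'cV[R]_n, mxle 0 z & mxle (M *m z) d) ->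
  exists u : 'rV[R]_k,
    [/\ mxle 0 u, mxle 0 (u *m M) & (u *m d) ord0 ord0 < 0].
Proof.
move=> infeas.
pose H : 'M[R]_(k + (n + 1), n + 1) :=
  col_mx (row_mx M (- d)) (- 1%:M).
have [x|u u0] := farkas (A := H) (c := row_mx 0 1%:M).
  rewrite -(vsubmxK x); move: (usubmx x) (dsubmx x) => z s {x}.
  rewrite mul_col_mx mul_row_col !mulNmx mul1mx -[X in mxle _ X -> _]col_mx0.
  move=> /mxle_col_mx[Mz]; rewrite -[X in mxle _ X -> _]oppr0 => /mxle_opp.
  rewrite -[X in mxle X]col_mx0 => /mxle_col_mx[z0 s0].
  rewrite mul_row_col mul0mx add0r mul1mx; apply/mxle11.
  rewrite [leRHS]mxE leNgt; apply/negP => s_gt0; apply: infeas.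
  set t := s ord0 ord0 in s_gt0.
  exists (t^-1 *: z).
    rewrite -[X in mxle X](scaler0 _ t^-1); apply: mxle_scale => //.
    by rewrite invr_ge0 ltW.
  rewrite -scalemxAr -[d]scale1r -(mulVf (lt0r_neq0 s_gt0)) -scalerA.
  apply: mxle_scale; first by rewrite invr_ge0 ltW.
  move: Mz => /mxle_subr0.
  by rewrite {1}[s]mx11_scalar mul_mx_scalar.
move: u0; rewrite -(hsubmxK u); move: (lsubmx u) (rsubmx u) => {u} u v.
rewrite -[X in mxle X]row_mx0 => /mxle_row_mx[u0].
rewrite -(hsubmxK v); move: (lsubmx v) (rsubmx v) => {v} p q.
rewrite -[X in mxle X]row_mx0 => /mxle_row_mx[p0 q0].
rewrite mul_row_col mulmxN mulmx1 mul_mx_row opp_row_mx add_row_mx.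
move=> /eq_row_mx[/esym/eqP]; rewrite subr_eq0 => /eqP uM ud.
exists u; split=> //; first by rewrite uM.
have -> : u *m d = - (1%:M + q) by rewrite {1}ud mulmxN subrK opprK.
rewrite !mxE eqxx oppr_lt0 ltr_pwDl //.
by have := q0 ord0 ord0; rewrite mxE.
Qed.

(** Strong duality for max c x s.t. A x <= b, x >= 0 and its dual
    min y b s.t. y A >= c, y >= 0, dual vectors being rows. *)
Lemma lp_strong_duality n m (A : 'M[R]_(n, m)) (b : 'cV[R]_n) (c : 'rV[R]_m)
    (x0 : 'cV[R]_m) (y0 : 'rV[R]_n) :
  mxle 0 x0 -> mxle (A *m x0) b -> mxle 0 y0 -> mxle c (y0 *m A) ->
  exists x y, [/\ mxle 0 x, mxle (A *m x) b, mxle 0 y, mxle c (y *m A)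
                & mxle (y *m b) (c *m x)].
Proof.
move=> x0_ge0 Ax0 y0_ge0 y0A.
(* Both feasibility conditions and the reverse of weak duality form one
   system of inequalities in (x, y^T). *)
pose M := col_mx (block_mx A 0 0 (- A^T)) (row_mx (- c) b^T).
pose d : 'cV[R]_(n + m + 1) := col_mx (col_mx b (- c^T)) 0.
have [[z]|] := pselect (exists2 z : 'cV[R]_(m + n), mxle 0 z & mxle (M *m z) d).
  rewrite -(vsubmxK z); move: (usubmx z) (dsubmx z) => x yt {z}.
  rewrite -[X in mxle X]col_mx0 => /mxle_col_mx[x_ge0 yt_ge0].
  rewrite mul_col_mx mul_block_col mul_row_col !mul0mx addr0 add0r !mulNmx.
  move=> /mxle_col_mx[/mxle_col_mx[Ax /mxle_opp Ayt]].
  rewrite addrC => /mxle_subr0 gap.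
  exists x, yt^T; split=> //.
  - by rewrite -trmx0; apply: mxle_tr.
  - by rewrite -[c]trmxK -[A]trmxK -trmx_mul; apply: mxle_tr.
  - by apply/mxle11; have := gap ord0 ord0; rewrite -{1}[yt]trmxK -trmx_mul mxE.
(* A certificate (p, q, s) of infeasibility satisfies p A >= s c and
   A q^T <= s b, although p b < c q^T. *)
case/lp_infeasible => u; rewrite -(hsubmxK u).
move: (lsubmx u) (rsubmx u) => {u} u t [].
rewrite -[X in mxle X]row_mx0 => /mxle_row_mx[].
rewrite -(hsubmxK u); move: (lsubmx u) (rsubmx u) => {u} p q.
rewrite -[X in mxle X]row_mx0 => /mxle_row_mx[p_ge0 q_ge0] /mxle11.
rewrite [leLHS]mxE => s_ge0; rewrite [t]mx11_scalar.
move: (t ord0 ord0) s_ge0 => s s_ge0 {t}.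
rewrite /M /d mul_row_col mul_row_block !mul_row_col !mulmx0 !addr0 add0r.
rewrite mul_mx_row add_row_mx.
rewrite !mul_scalar_mx !mulmxN scalerN.
rewrite -[X in mxle X]row_mx0 => /mxle_row_mx[/mxle_sub0r pA].
rewrite addrC => /mxle_sub0r qA.
pose v := q^T; have v_ge0 : mxle 0 v by rewrite -trmx0; apply: mxle_tr.
have Av : mxle (A *m v) (s *: b).
  by have := mxle_tr qA; rewrite trmx_mul trmxK linearZ /= trmxK.
have -> : q *m c^T = c *m v.
  by rewrite -[q]trmxK -trmx_mul [LHS]mx11_scalar mxE -mx11_scalar.
rewrite mxE [X in _ + X]mxE subr_lt0 => /lt_geF/negbT/negP[].
move: s_ge0; rewrite le_eqVlt => /predU1P[s0|s_gt0].
  (* For s = 0, the vectors p and v are recession directions of the dual and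
     of the primal; comparison with y0 and x0 gives c v <= 0 <= p b. *)
  rewrite -s0 !scale0r in pA Av.
  apply: (@le_trans _ _ 0).
    have /mxle11 : mxle (c *m v) 0.
      apply: mxle_trans (mxle_mul2r v_ge0 y0A) _.
      by rewrite -mulmxA -(mulmx0 _ y0); apply: mxle_mul2l.
    by rewrite [leRHS]mxE.
  have /mxle11 : mxle 0 (p *m b).
    apply: mxle_trans (mxle_mul2l p_ge0 Ax0).
    by rewrite mulmxA -(mul0mx _ x0); apply: mxle_mul2r.
  by rewrite [leLHS]mxE.
(* For s > 0, p / s and v / s are feasible, so p b < c v contradicts weak
   duality. *)
have /mxle11 : mxle (s *: (c *m v)) (s *: (p *m b)).
  rewrite scalemxAl scalemxAr; apply: mxle_trans (mxle_mul2r v_ge0 pA) _.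
  by rewrite -mulmxA; apply: mxle_mul2l.
by rewrite !mxE ler_pM2l.
Qed.

End Duality.

(** * Maxima *)

Section Maxima.
Context {R : realType}.

Lemma maxvalE (T : Type) (D : set T) (g : T -> R) (x : T) :
  argmax D g x -> maxval D g = g x.
Proof.
move=> [Dx gx]; rewrite /maxval.
have [z [Dz gz] <-] := @xgetPex _ 0 (g @` argmax D g)
  (ex_intro _ (g x) (ex_intro2 _ _ x (conj Dx gx) erefl)).
by apply/eqP; rewrite eq_le gx //= gz.
Qed.

End Maxima.

(** * The core and the dual polyhedron *)

Section Core.
Context {R : realType} (n m : nat) (b : R) (A : 'M[R]_(n, m)).
Context (f : 'cV[R]_m -> R).

(** The objective vector of the linear program, up to the factor b^-1. *)
Definition unit_values : 'rV[R]_m := \row_(j < m) f (b *: unitv j).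

(** The feasible set of the dual linear program. *)
Definition dual_feasible : set 'cV[R]_n :=
  [set y | nonneg n 1 y /\ mxle unit_values (y^T *m A)].

Lemma dotC k (u v : 'cV[R]_k) : dot u v = dot v u.
Proof. by rewrite /dot !mxE; apply: eq_bigr => i _; rewrite !mxE mulrC. Qed.

Lemma dot_unitv k (i : 'I_k) (y : 'cV[R]_k) : dot (unitv i) y = y i ord0.
Proof. by rewrite /dot /unitv trmx_delta -rowE mxE. Qed.

Lemma linear_extE (x : 'cV[R]_m) :
  linear_ext b f x = b^-1 * (unit_values *m x) ord0 ord0.
Proof.
by rewrite /linear_ext mxE; congr (_ * _); apply: eq_bigr => j _; rewrite mxE.
Qed.

Lemma dual_feasible_exists :
  binary n m A -> (forall j, col j A <> 0) -> dual_feasible !=set0.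
Proof.
move=> A01 Acol.
have A_ge0 i j : 0 <= A i j by case: (A01 i j) => ->.
(* Column j of A has an entry 1, so a constant vector with entries at least
   |f(b e_j)| satisfies the j-th inequality. *)
pose C := \sum_j `|unit_values ord0 j|.
have C_ge0 : 0 <= C by apply: sumr_ge0.
exists (const_mx C); split=> [i j | i j]; first by rewrite !mxE.
rewrite ord1 [leRHS]mxE.
have [k Akj] : exists k, A k j = 1.
  apply: contrapT => noA; apply: (Acol j); apply/colP => k; rewrite !mxE.
  by case: (A01 k j) => // Akj; case: noA; exists k.
apply: (@le_trans _ _ C).
  apply: le_trans (ler_norm _) _.
  by rewrite /C (bigD1 j) //= lerDl sumr_ge0.
rewrite (bigD1 k) //= !mxE Akj mulr1 lerDl sumr_ge0 // => i0 _.
by rewrite !mxE mulr_ge0.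
Qed.

Hypothesis b_gt0 : 0 < b.

Lemma weak_duality (w : 'cV[R]_n) (y : 'cV[R]_n) (x : 'cV[R]_m) :
  dual_feasible y -> nonneg m 1 x -> mxle (A *m x) (b *: w) ->
  linear_ext b f x <= dot w y.
Proof.
move=> [y0 yA] x0 Ax; rewrite linear_extE ler_pdivrMl // dotC /dot.
have /mxle11 : mxle (unit_values *m x) (b *: (y^T *m w)).
  rewrite scalemxAr; apply: mxle_trans (mxle_mul2r x0 yA) _.
  by rewrite -mulmxA; apply: mxle_mul2l => //; rewrite -trmx0; apply: mxle_tr.
by rewrite [leRHS]mxE.
Qed.

Section Revenue.
Variable X : set 'cV[R]_m.
Hypothesis A_binary : binary n m A.
Hypothesis X_lower : [set 0] `|` [set b *: unitv j | j in [set: 'I_m]] `<=` X.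
Hypothesis X_upper : X `<=` nonneg m 1.
Hypothesis f0 : f 0 = 0.
Hypothesis f_subadd : individually_subadditive b X f.
Hypothesis attained : forall w : 'cV[R]_n, binary n 1 w ->
  argmax (feasible A b X w) f !=set0.

Let F := linear_ext b f.
Let nu := revenue A b X f.

Lemma subadditive_le_linear_ext x : X x -> f x <= F x.
Proof.
move=> Xx; rewrite /F /linear_ext; under eq_bigr do rewrite mulrC.
exact: f_subadd.
Qed.

Lemma ones_binary : binary n 1 (ones n : 'cV[R]_n).
Proof. by move=> i j; right; rewrite mxE. Qed.

Lemma le_revenue (w : 'cV[R]_n) x :
  binary n 1 w -> feasible A b X w x -> f x <= nu w.
Proof.
move=> w01 xw; have [z zmax] := attained w01.
by rewrite /nu /revenue (maxvalE zmax); case: zmax => _; apply.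
Qed.

Lemma revenue_le_dual (w y : 'cV[R]_n) :
  binary n 1 w -> dual_feasible y -> nu w <= dot w y.
Proof.
move=> w01 yD; have [z zmax] := attained w01.
rewrite /nu /revenue (maxvalE zmax); case: zmax => -[Xz Az] _.
apply: le_trans (subadditive_le_linear_ext Xz) _.
exact: weak_duality (X_upper Xz) Az.
Qed.

Lemma core_dual_feasible y : core nu y -> dual_feasible y.
Proof.
move=> [_ y_core]; split=> [i k | k j].
  have e01 : binary n 1 (unitv i : 'cV[R]_n).
    by move=> i' k'; rewrite mxE; case: (_ && _); [right | left].
  rewrite (ord1 k) mxE -dot_unitv; apply: le_trans (y_core _ e01).
  rewrite -f0; apply: le_revenue => //; split; first by apply: X_lower; left.
  move=> i' k'; rewrite mulmx0 !mxE.
  by rewrite mulr_ge0 ?ler0n // ltW.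
have c01 : binary n 1 (col j A) by move=> i' k'; rewrite mxE.
have -> : (y^T *m A) k j = dot (col j A) y.
  by rewrite (ord1 k) dotC /dot !mxE; apply: eq_bigr => i _; rewrite !mxE.
rewrite mxE; apply: le_trans (y_core _ c01).
apply: le_revenue => //; split; first by apply: X_lower; right; exists j.
by move=> i' k'; rewrite -scalemxAr colE.
Qed.

Lemma coreE :
  core nu = [set y | dual_feasible y /\ dot (ones n) y = nu (ones n)].
Proof.
apply/seteqP; split=> y [].
  by move=> y1 y_core; split=> //; apply: core_dual_feasible.
by move=> yD y1; split=> // a a01; apply: revenue_le_dual.
Qed.

(** If the core is non-empty, a maximiser of f over X also solves the linear
    program, with the same value. *)
Lemma core_argmax y : core nu y ->
  exists x, [/\ X x, argmax (feasible A b (nonneg m 1) (ones n)) F x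
              & F x = nu (ones n)].
Proof.
rewrite coreE => -[yD y1].
have [x xmax] := attained ones_binary; exists x.
have nuE : nu (ones n) = f x by exact: maxvalE.
case: xmax => -[Xx Ax] _.
have Fx : F x = nu (ones n).
  apply/eqP; rewrite eq_le -{1}y1 nuE subadditive_le_linear_ext // andbT.
  exact: weak_duality (X_upper Xx) Ax.
split=> //; split; first by split=> //; apply: X_upper.
by move=> z [z0 Az]; rewrite Fx -y1; apply: weak_duality.
Qed.

End Revenue.
End Core.

Theorem theorem8 (R : realType) (n m : nat) (b : R) (A : 'M[R]_(n, m))
    (X : set 'cV[R]_m) (f : 'cV[R]_m -> R)
    (b_gt0 : 0 < b)
    (A_binary : binary n m A)
    (A_col : forall j : 'I_m, col j A <> 0)
    (X_lower : [set 0] `|` [set b *: unitv j | j in [set: 'I_m]] `<=` X)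
    (X_upper : X `<=` nonneg m 1)
    (f0 : f 0 = 0)
    (f_subadd : individually_subadditive b X f)
    (attained : forall w : 'cV[R]_n, binary n 1 w ->
      argmax (feasible A b X w) f !=set0) :
  let F := linear_ext b f in
  let nu := revenue A b X f in
  let nuF := revenue A b (nonneg m 1) F in
  [/\ core nu !=set0 <-> nu (ones n) = nuF (ones n),
      core nu !=set0 ->
        core nu =
        argmin [set y | nonneg n 1 y /\
                        mxle (\row_(j < m) f (b *: unitv j)) (y^T *m A)]
               (dot (ones n))
    & X = binary m 1 -> core nu !=set0 ->
        exists x, argmax (feasible A b (nonneg m 1) (ones n)) F x /\
                  forall j, x j ord0 \is a Num.int].
Proof.
move=> F nu nuF.
have nu_core := coreE b_gt0 A_binary X_lower X_upper f0 f_subadd attained.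
have opt := core_argmax b_gt0 A_binary X_lower X_upper f0 f_subadd attained.
rewrite -/nu -/F in nu_core opt.
split; first split.
- case=> y /opt[x [_ xmax <-]]; exact/esym/maxvalE.
- move=> nuE; have [y0 [y0_ge0 y0A]] := dual_feasible_exists b f A_binary A_col.
  have [||||x [yt [x_ge0 Ax yt_ge0 ytA gap]]] :=
    lp_strong_duality (A := A) (b := b *: ones n) (c := unit_values b f)
      (x0 := 0) (y0 := y0^T) => //.
  + by move=> i j; rewrite mulmx0 !mxE mulr1 ltW.
  + by rewrite -trmx0; apply: mxle_tr.
  have yD : dual_feasible b A f yt^T.
    split; last by rewrite trmxK.
    by change (mxle 0 yt^T); rewrite -trmx0; apply: mxle_tr.
  have y_le : dot (ones n) yt^T <= F x.
    rewrite /F linear_extE ler_pdivlMl // dotC /dot trmxK.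
    by move: gap => /mxle11; rewrite -scalemxAr mxE.
  have xmax : argmax (feasible A b (nonneg m 1) (ones n)) F x.
    split=> // z [z_ge0 Az]; apply: le_trans y_le.
    exact: weak_duality yD z_ge0 Az.
  exists yt^T; rewrite nu_core; split=> //; apply/eqP.
  rewrite nuE /nuF /revenue (maxvalE xmax) eq_le y_le.
  exact: weak_duality yD x_ge0 Ax.
- case=> y /[dup] /opt[x [_ [[x_ge0 Ax] _] Fx]]; rewrite nu_core => -[yD y1].
  apply/seteqP; split=> z [zD z1]; split=> //.
    by move=> t tD; rewrite z1 -Fx; apply: weak_duality tD x_ge0 Ax.
  apply/eqP; rewrite eq_le -{1}y1 z1 //= -Fx.
  exact: weak_duality zD x_ge0 Ax.
- move=> XE [y /opt[x [Xx xmax _]]]; exists x; split=> // j.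
  by move: Xx; rewrite XE => /(_ j ord0)[] ->; rewrite ?rpred0 ?rpred1.
Qed.
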